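(* Let $k$ be a field, $R=k[x_1,\ldots,x_n]$ with its standard $\mathbb{Z}^n$-grading, and let $I\subseteq R$ be a monomial ideal with pure resolution. Then $I$ is a Betti-linear ideal.
   Context: Let $\mathcal{F}\colon 0\leftarrow F_0\xleftarrow{\phi_1}F_1\leftarrow\cdots\leftarrow F_m\leftarrow 0$ be the minimal $\mathbb{Z}^n$-graded free resolution of $I$ over $R$ (as a module, so $F_0$ has one basis element for each minimal monomial generator). $I$ has *pure resolution* if for each $i$ there is an integer $d_i$ such that all homogeneous basis elements of $F_i$ have total ($\mathbb{Z}$-)degree $d_i$. The *Betti poset* $B$ of $I$ over $k$ is the set of $\mathbb{Z}^n$-degrees of homogeneous basis elements of the modules $F_i$ (all $i$), ordered by divisibility of monomials (componentwise order in $\mathbb{Z}^n$). Write $y\lessdot_Bx$ if $y<x$ in $B$ and there is no $z\in B$ with $y<z<x$. $I$ is *Betti-linear* if one can choose $\mathbb{Z}^n$-homogeneous bases $B_t$ of $F_t$ for all $t$ so that for all $i\ge1$ and all $\tau\in B_i$, writing $\phi_i(\tau)=\sum_{\gamma\in B_{i-1}}[\tau:\gamma]\,\gamma$ with $[\tau:\gamma]\in R$, one has: $[\tau:\gamma]\neq0$ implies $\mathrm{mdeg}(\gamma)\lessdot_B\mathrm{mdeg}(\tau)$, where $\mathrm{mdeg}$ denotes the $\mathbb{Z}^n$-degree. *)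

(* Defs.v *)
From HB Require Import structures.
From mathcomp Require Import all_boot all_order all_algebra.
From mathcomp Require Import mpoly.

Set Implicit Arguments.
Unset Strict Implicit.
Unset Printing Implicit Defensive.

Import Order.TTheory GRing.Theory Num.Theory.
Local Open Scope ring_scope.

(* Z^n, with the componentwise order; on degrees of monomials this order is
   divisibility. *)
Notation zdeg n := 'rV[int]_n.

Definition zle n (a b : zdeg n) : Prop := forall i : 'I_n, a 0 i <= b 0 i.
Definition zlt n (a b : zdeg n) : Prop := zle a b /\ a <> b.

Definition total_deg n (a : zdeg n) : int := \sum_(i < n) a 0 i.

Definition mono_deg n (m : 'X_{1..n}) : zdeg n := \row_(i < n) (m i)%:Z.

(* The ideals of mathcomp's ring_quotient are boolean and proper; here an ideal
   is a Prop-valued predicate, and both 0 and the whole ring are allowed. *)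
Definition monomial_ideal (k : fieldType) (n : nat)
    (I : {mpoly k[n]} -> Prop) : Prop :=
  exists S : 'X_{1..n} -> Prop, forall p : {mpoly k[n]},
    I p <-> exists (r : nat) (c : 'I_r -> {mpoly k[n]}) (m : 'I_r -> 'X_{1..n}),
              (forall i, S (m i)) /\ p = \sum_(i < r) c i * 'X_[m i].

(* F_t is the free module of row vectors of length [rk t] over R = k[x_1..x_n],
   graded so that its j-th standard basis vector has degree [sdeg t j], i.e.
   F_t is the direct sum of the R(- sdeg t j).  Maps act on the right of row
   vectors: [diff t] is phi_(t+1) : F_(t+1) -> F_t, and row j of [diff t] is the
   image of the j-th basis vector.  [aug] is the augmentation F_0 -> R, whose
   image is to be the resolved ideal. *)
Record free_complex (k : fieldType) (n : nat) := FreeComplex {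
  rk : nat -> nat;
  sdeg : forall t, 'I_(rk t) -> zdeg n;
  diff : forall t, 'M[{mpoly k[n]}]_(rk t.+1, rk t);
  aug : 'cV[{mpoly k[n]}]_(rk 0)
}.

Section Resolutions.
Variables (k : fieldType) (n : nat) (F : free_complex k n).
Local Notation R := {mpoly k[n]}.

Definition homogeneous t (d : zdeg n) (v : 'rV[R]_(rk F t)) : Prop :=
  forall (j : 'I_(rk F t)) (m : 'X_{1..n}),
    m \in msupp (v 0 j) -> mono_deg m + sdeg j = d.

(* The maps preserve degrees. *)
Definition graded : Prop :=
  (forall (j : 'I_(rk F 0)) (m : 'X_{1..n}),
     m \in msupp (aug F j 0) -> mono_deg m = sdeg j)
  /\ (forall t (j : 'I_(rk F t.+1)), homogeneous (sdeg j) (row j (diff F t))).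

Definition resolves (I : R -> Prop) : Prop :=
  [/\ forall p : R, I p <-> exists v : 'rV_(rk F 0), (v *m aug F) 0 0 = p,
      forall v : 'rV_(rk F 0),
        v *m aug F = 0 <-> exists w, v = w *m diff F 0,
      forall t (v : 'rV_(rk F t.+1)),
        v *m diff F t = 0 <-> exists w, v = w *m diff F t.+1
    & exists l, forall t, (l < t)%N -> rk F t = 0%N].

(* phi_(t+1) maps F_(t+1) into (x_1, ..., x_n) F_t. *)
Definition minimal : Prop :=
  forall t (i : 'I_(rk F t.+1)) (j : 'I_(rk F t)), (diff F t i j)@_0%MM = 0.

Definition minimal_graded_free_resolution (I : R -> Prop) : Prop :=
  [/\ graded, resolves I & minimal].

Definition pure : Prop :=
  exists d : nat -> int, forall t (j : 'I_(rk F t)), total_deg (sdeg j) = d t.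

Definition betti_poset (a : zdeg n) : Prop :=
  exists t (j : 'I_(rk F t)), sdeg j = a.

Definition betti_covers (y x : zdeg n) : Prop :=
  [/\ betti_poset y, betti_poset x, zlt y x
    & ~ exists z, [/\ betti_poset z, zlt y z & zlt z x]].

(* The rows of [b] form a basis of F_t, the j-th one homogeneous of degree
   [mdg j]. *)
Definition homogeneous_basis t s (b : 'M[R]_(s, rk F t))
    (mdg : 'I_s -> zdeg n) : Prop :=
  (forall v : 'rV_(rk F t), exists! c : 'rV_s, v = c *m b)
  /\ (forall j, homogeneous (mdg j) (row j b)).

(* [c t] is the matrix of phi_(t+1) in the chosen bases, its (tau, gamma) entry
   being [tau : gamma]. *)
Definition betti_linear : Prop :=
  exists (s : nat -> nat) (b : forall t, 'M[R]_(s t, rk F t))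
         (mdg : forall t, 'I_(s t) -> zdeg n)
         (c : forall t, 'M[R]_(s t.+1, s t)),
    [/\ forall t, homogeneous_basis (b t) (@mdg t),
        forall t, b t.+1 *m diff F t = c t *m b t
      & forall t (tau : 'I_(s t.+1)) (gamma : 'I_(s t)),
          c t tau gamma != 0 -> betti_covers (mdg t gamma) (mdg t.+1 tau)].

End Resolutions.

(* Main.v *)
(* In a minimal resolution every basis element of F_(t+1) has a nonzero image,
   with entries of positive degree, so the degrees d_t of a pure resolution
   strictly increase as long as F_t is nonzero.  An element of the Betti poset
   strictly between the degrees of gamma in F_t and tau in F_(t+1) would thus
   belong to some F_s with t < s < t + 1.  Hence the given bases already witness
   Betti-linearity. *)
Require Import Defs.
From HB Require Import structures.
From mathcomp Require Import all_boot all_order all_algebra.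
From mathcomp Require Import mpoly.
Import Order.TTheory GRing.Theory Num.Theory.
Local Open Scope ring_scope.

Lemma total_deg_lt n (a b : zdeg n) : zlt a b -> total_deg a < total_deg b.
Proof.
case=> le_ab neq_ab; rewrite lt_neqAle ler_sum // andbT.
apply/eqP => eq_ab; apply: neq_ab; apply/rowP => i; apply/eqP.
have sum0 : \sum_(j < n) (b 0 j - a 0 j) == 0.
  by rewrite sumrB subr_eq0 eq_sym; apply/eqP.
rewrite psumr_eq0 in sum0 => [|j _]; last by rewrite subr_ge0.
by rewrite eq_sym -subr_eq0; apply: (allP sum0); rewrite mem_index_enum.
Qed.

Section MinimalComplex.
Variables (k : fieldType) (n : nat) (F : free_complex k n).
Hypotheses (gradedF : graded F) (minF : minimal F).

(** By gradedness, any monomial [m] in the support of the entry has degree [sdeg i - sdeg j], so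
    this difference is nonnegative. It is not zero, since minimality excludes [m = 1]. *)
Lemma sdeg_lt_of_diff_neq0 t (i : 'I_(rk F t.+1)) (j : 'I_(rk F t)) :
  diff F t i j != 0 -> zlt (sdeg j) (sdeg i).
Proof.
move=> nz; have mem_lead := mlead_supp nz; set m := mlead _ in mem_lead.
have deg_m : mono_deg m + sdeg j = sdeg i.
  by apply: gradedF.2; rewrite mxE.
split=> [l|eq_deg]; first by rewrite -deg_m !mxE lerDr.
have m0 : m = 0%MM.
  apply/mnmP => l; have /rowP/(_ l) := deg_m.
  rewrite eq_deg !mxE mnm0E => /eqP.
  by rewrite -subr_eq0 addrK => /eqP [].
by move: mem_lead; rewrite m0 mcoeff_msupp minF eqxx.
Qed.

Lemma mcoeff0_mul_diff t (w : 'rV_(rk F t.+1)) j :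
  ((w *m diff F t) 0 j)@_0%MM = 0.
Proof.
rewrite mxE raddf_sum big1 // => i _.
by rewrite /= -[LHS]/(mcoeff 0%MM _) rmorphM /= minF mulr0.
Qed.

(** If row [i] vanished, exactness would place the [i]-th basis vector in the image of
    [diff F t.+1]; by minimality all coordinates there have zero constant term, but its [i]-th
    coordinate is 1. *)
Lemma diff_row_neq0 t (i : 'I_(rk F t.+1)) :
  (forall v : 'rV_(rk F t.+1),
     v *m diff F t = 0 -> exists w, v = w *m diff F t.+1) ->
  exists j, diff F t i j != 0.
Proof.
move=> exactF; apply/existsP; apply: contraT.
rewrite negb_exists => /forallP row0.
have [|w] := exactF (delta_mx 0 i).
  by rewrite -rowE; apply/rowP => j; rewrite !mxE; apply/eqP/negbNE.
move=> /rowP/(_ i)/(congr1 (mcoeff 0%MM)).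
rewrite mcoeff0_mul_diff !mxE !eqxx /= mcoeff1 eqxx => /eqP.
by rewrite oner_eq0.
Qed.

End MinimalComplex.

(** The inhabitant of ['I_(rk F t)] ensures that [F_t] is nonzero. A nonzero entry in its row yields
    a basis element one step lower, which feeds the induction on [t]. *)
Lemma pure_degree_le {k : fieldType} {n : nat} {I : {mpoly k[n]} -> Prop}
    {F : free_complex k n} {d : nat -> int} :
  minimal_graded_free_resolution F I ->
  (forall t (j : 'I_(rk F t)), total_deg (sdeg j) = d t) ->
  forall s t, (s <= t)%N -> 'I_(rk F t) -> d s <= d t.
Proof.
case=> gradedF [_ _ exactF _] minF degF s; elim=> [|t IHt].
  by rewrite leqn0 => /eqP->.
rewrite leq_eqVlt => /predU1P[-> //|]; rewrite ltnS => le_st i.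
have [v|j nz] := @diff_row_neq0 _ _ _ minF t i; first exact: (exactF t v).1.
apply: le_trans (IHt le_st j) _.
rewrite -(degF _ i) -(degF _ j) ltW //; apply: total_deg_lt.
exact: sdeg_lt_of_diff_neq0.
Qed.

Theorem proposition2p4 (k : fieldType) (n : nat) (I : {mpoly k[n]} -> Prop)
  (F : free_complex k n)
  (hI : monomial_ideal I)
  (hF : minimal_graded_free_resolution F I)
  (hpure : pure F) :
  betti_linear F.
Proof.
have [d degF] := hpure; have [gradedF _ minF] := hF.
exists (rk F), (fun=> 1%:M), (@sdeg _ _ F), (diff F); split=> [t|t|t i j nz].
- split=> [v|j l m].
    by exists v; split=> [|c ->]; rewrite mulmx1.
  rewrite !mxE; case: eqP => [<-|_]; last by rewrite msupp0.
  rewrite msupp1 inE => /eqP->; apply/rowP => a.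
  by rewrite !mxE mnm0E add0r.
- by rewrite mul1mx mulmx1.
split; [by exists t, j | by exists t.+1, i | exact: sdeg_lt_of_diff_neq0 |].
case=> _ [[s [l <-]] /total_deg_lt lt_js /total_deg_lt lt_si].
rewrite !degF in lt_js lt_si.
(* Here [d t < d s < d t.+1]. Monotonicity is applied up to [j] in [F_t] if [s <= t], and up to [l]
   in [F_s] otherwise. *)
have [le_st|lt_ts] := leqP s t.
  by have := pure_degree_le hF degF _ _ le_st j; rewrite leNgt lt_js.
by have := pure_degree_le hF degF _ _ lt_ts l; rewrite leNgt lt_si.
Qed.
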